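(* Let $V$ be a ground set of $n$ elements, $f$ a nonnegative symmetric submodular function on $V$, and $w:V\to\mathbb{R}_{\ge0}$ weights. Let $0<b'<b\le 1/2$ with $b'\le 1/3$. Consider the procedure: initialize $w'=w$ and $T=\emptyset$; while $w'(V)>(1-b')w(V)$, let $S$ be a $\gamma$-approximate solution to the weighted Submodular Sparsest Cut problem on $V$, $f$ with weights $w'$, let $S_i$ be whichever of $S$, $V\setminus S$ has smaller $w'$-weight, set $w'(v)=0$ for all $v\in S_i$, and set $T\leftarrow T\cup S_i$; finally return $T$. Here the subroutine's approximation ratio is $\gamma=O(\sqrt{n/\ln n})$. If $(V,f,w)$ contains a $b$-balanced cut of cost $B$, then this procedure finds a $b'$-balanced cut $T$ with $f(T)=O\left(\frac{B}{b-b'}\sqrt{\frac{n}{\ln n}}\right)$.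
   Context: $f$ is submodular if $f(S)+f(T)\ge f(S\cup T)+f(S\cap T)$ for all $S,T$, and symmetric if $f(S)=f(V\setminus S)$ for all $S$. For $S\subseteq V$, $w(S)=\sum_{v\in S}w(v)$. A cut $(S,V\setminus S)$ is $b$-balanced if $w(S)\ge b\,w(V)$ and $w(V\setminus S)\ge b\,w(V)$; its cost is $f(S)$. The weighted Submodular Sparsest Cut problem with weights $w'$ is to find $S$ minimizing $f(S)/(w'(S)\,w'(V\setminus S))$ (demand of each pair $\{u,v\}$ is $w'(u)w'(v)$); a $\gamma$-approximate solution has objective at most $\gamma$ times the minimum. *)

(* Defs.v *)
From HB Require Import structures.
From Stdlib Require Export Relation_Operators.
From mathcomp Require Export all_boot all_order all_algebra.
From mathcomp Require Export all_classical all_reals all_analysis.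
Export Order.TTheory GRing.Theory Num.Theory.
Export numFieldNormedType.Exports.

Set Implicit Arguments.
Unset Strict Implicit.
Unset Printing Implicit Defensive.

Local Open Scope ring_scope.

Section SubmodularCuts.
Variables (R : realType) (V : finType).
Implicit Types (f : {set V} -> R) (w : V -> R) (S T : {set V}).

Definition nonnegative f := forall S, 0 <= f S.

Definition symmetric_setfun f := forall S, f S = f (~: S).

Definition submodular f :=
  forall S T, f (S :|: T) + f (S :&: T) <= f S + f T.

Definition weight w S : R := \sum_(v in S) w v.

Definition balanced w (b : R) S :=
  b * weight w [set: V] <= weight w S /\
  b * weight w [set: V] <= weight w (~: S).

(* The ratio f(S) / (w(S) w(V \ S)) only makes sense when both sides of the cut
   have positive weight; candidates are restricted to those sets, because
   division by zero is zero in MathComp and would create spurious minimizers. *)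
Definition candidate w S := 0 < weight w S /\ 0 < weight w (~: S).

Definition sparsity f w S : R := f S / (weight w S * weight w (~: S)).

Definition sparsest_cut f w S :=
  candidate w S /\ forall S', candidate w S' -> sparsity f w S <= sparsity f w S'.

Definition approx_sparsest_cut (g : R) f w S :=
  candidate w S /\
  exists2 Smin, sparsest_cut f w Smin & sparsity f w S <= g * sparsity f w Smin.

(* Loop state: the current weights w' and the current set T. *)
Definition state : Type := ((V -> R) * {set V})%type.

Definition init w : state := (w, finset.set0).

Definition loop_guard (b' : R) w (s : state) :=
  (1 - b') * weight w [set: V] < weight s.1 [set: V].

Definition zero_on S w : V -> R := fun v => if v \in S then 0 else w v.

(* One iteration of the loop body. The subroutine may return any g-approximate
   solution, independently at each iteration, and ties between the w'-weights
   of S and of its complement may be broken either way. *)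
Inductive step (g b' : R) f w : state -> state -> Prop :=
| Step (w' : V -> R) (T S Si : {set V}) :
    loop_guard b' w (w', T) ->
    approx_sparsest_cut g f w' S ->
    Si = S \/ Si = ~: S ->
    weight w' Si <= weight w' (~: Si) ->
    step g b' f w (w', T) (zero_on Si w', T :|: Si).

Definition reachable (g b' : R) f w (s : state) :=
  clos_refl_trans state (step g b' f w) (init w) s.

(* Every execution is finite. *)
Definition terminates (g b' : R) f w :=
  Acc (fun s' s => step g b' f w s s') (init w).

(* The loop body can be executed whenever the loop is entered. *)
Definition never_stuck (g b' : R) f w :=
  forall s, reachable g b' f w s -> loop_guard b' w s ->
  exists s', step g b' f w s s'.

Definition returns (g b' : R) f w T :=
  exists w', reachable g b' f w (w', T) /\ ~ loop_guard b' w (w', T).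

End SubmodularCuts.

Definition sqrt_n_ln (R : realType) (n : nat) : R := Num.sqrt (n%:R / ln n%:R).

(* Main.v *)
Require Import Defs.
From Stdlib Require Import Operators_Properties.
From mathcomp Require Import ring lra.

(* While the loop runs, less than a b' fraction of the weight has been removed,
   so a b-balanced cut A of cost B still has residual weight at least
   (b - b') w(V) on both sides.  Comparing the sparsity of the chosen cut with
   that of A gives f(S_i) <= 2 gamma B / ((b - b') w(V)) * w'(S_i).  The sets
   S_i remove disjoint parts of the weight, so summing these bounds and using
   subadditivity of f yields f(T) <= f(set0) + 2 gamma B / (b - b'), while
   f(set0) <= B by symmetry.  Finally, S_i is the lighter side of the residual
   weight, so the last step leaves at least (1 - b') / 2 >= b' of the weight
   outside T. *)

Set Implicit Arguments.
Unset Strict Implicit.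
Unset Printing Implicit Defensive.

Local Open Scope ring_scope.

(** * Set weights under zeroing *)

Section Weights.
Variables (R : realType) (V : finType).
Implicit Types (w : V -> R) (S T A : {set V}).

Lemma eq_weight w1 w2 S : w1 =1 w2 -> weight w1 S = weight w2 S.
Proof. by move=> e; apply: eq_bigr => v _; exact: e. Qed.

Lemma weight_ge0 w S : (forall v, 0 <= w v) -> 0 <= weight w S.
Proof. by move=> w0; apply: sumr_ge0 => v _. Qed.

Lemma zero_on_ge0 w T : (forall v, 0 <= w v) -> forall v, 0 <= zero_on T w v.
Proof. by move=> w0 v; rewrite /zero_on; case: ifP. Qed.

Lemma weightC w S : weight w S + weight w (~: S) = weight w [set: V].
Proof.
rewrite /weight [RHS](bigID (mem S)) /=; congr (_ + _); apply: eq_bigl => v;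
  by rewrite !inE.
Qed.

Lemma weight_zero_on w T S : weight (zero_on T w) S = weight w (S :\: T).
Proof.
rewrite /weight big_mkcond [RHS]big_mkcond /=; apply: eq_bigr => v _.
by rewrite !inE /zero_on; case: (v \in T); case: (v \in S).
Qed.

Lemma weightU w T S :
  weight w (T :|: S) = weight w T + weight (zero_on T w) S.
Proof.
rewrite weight_zero_on /weight [LHS](bigID (mem T)) /=; congr (_ + _);
  apply: eq_bigl => v; rewrite !inE; by case: (v \in T); case: (v \in S).
Qed.

Lemma weightT w T :
  weight w [set: V] = weight w T + weight (zero_on T w) [set: V].
Proof. by rewrite -weightU finset.setUT. Qed.

Lemma zero_on_weight_ge w T A : (forall v, 0 <= w v) ->
  weight w A - weight w T <= weight (zero_on T w) A.
Proof.
(* Weigh [A :|: T] in both orders: adding [A] to [T], then [T] to [A]. *)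
move=> w0; rewrite lerBlDl -weightU finset.setUC weightU lerDl.
by apply: weight_ge0; exact: zero_on_ge0.
Qed.

End Weights.

(** * Symmetric submodular functions and sparse cuts *)

Section CutFunctions.
Variables (R : realType) (V : finType) (f : {set V} -> R).
Hypotheses (f0 : nonnegative f) (fsym : symmetric_setfun f) (fsub : submodular f).

Lemma submodular_subadditive (S T : {set V}) : f (S :|: T) <= f S + f T.
Proof. by have := fsub S T; have := f0 (S :&: T); lra. Qed.

(** Submodularity applied to [A] and [~: A] gives $2f(\emptyset)\le 2f(A)$ by symmetry. As [f] need
    not vanish on the empty set, this pays for the initial [T]. *)
Lemma symmetric_submodular_set0_le (A : {set V}) : f finset.set0 <= f A.
Proof.
have := fsub A (~: A); rewrite finset.setUCr finset.setICr -(fsym A).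
by rewrite (fsym [set: V]) finset.setCT; lra.
Qed.

Lemma sparsity_ge0 (w : V -> R) (S : {set V}) :
  (forall v, 0 <= w v) -> 0 <= sparsity f w S.
Proof. by move=> w0; rewrite divr_ge0 ?mulr_ge0 ?weight_ge0. Qed.

Lemma sparsest_cut_exists (w : V -> R) (A : {set V}) :
  candidate w A -> exists S, sparsest_cut f w S.
Proof.
move=> [A1 A2].
pose P (S : {set V}) := (0 < weight w S) && (0 < weight w (~: S)).
have PA : P A by rewrite /P A1.
case: (@arg_minP _ _ _ A P (sparsity f w) PA) => S /andP[S1 S2] Smin.
by exists S; split=> // S' [S'1 S'2]; apply: Smin; rewrite /P S'1.
Qed.

Lemma approx_sparsest_cut_le (g G m : R) (w : V -> R) (S A Si : {set V}) :
  (forall v, 0 <= w v) -> g <= G -> 0 <= G -> 0 < m ->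
  m <= weight w A -> m <= weight w (~: A) ->
  approx_sparsest_cut g f w S -> Si = S \/ Si = ~: S ->
  f Si <= 2 * G * f A / m * weight w Si.
Proof.
move=> w0 gG G0 m0 mA mAC [[S1 S2] [Sm [_ Smin] gS]] SiS.
have cA : candidate w A by split; lra.
have hS : sparsity f w S <= G * sparsity f w A.
  apply: (le_trans gS); apply: (@le_trans _ _ (G * sparsity f w Sm)).
    by rewrite ler_wpM2r ?sparsity_ge0.
  by rewrite ler_wpM2l ?Smin.
have {}hS : sparsity f w Si <= G * sparsity f w A.
  case: SiS => -> //; rewrite /sparsity -fsym finset.setCK [X in _ / X]mulrC.
  exact: hS.
have [i1 i2] : 0 < weight w Si /\ 0 < weight w (~: Si).
  by case: SiS => ->; rewrite ?finset.setCK.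
have sA := weightC w A; have sS := weightC w Si.
have fA := f0 A.
move: hS; rewrite /sparsity ler_pdivrMr ?mulr_gt0 // => /le_trans; apply.
move: (weight w A) (weight w (~: A)) (weight w Si) (weight w (~: Si))
  (weight w [set: V]) mA mAC i1 i2 sA sS => p q x y s mp mq x0 y0 es1 es2.
have p0 : 0 < p by lra.
have q0 : 0 < q by lra.
have -> : G * (f A / (p * q)) * (x * y) = (G * f A * x) * (y / (p * q)).
  by field; rewrite !gt_eqF.
have -> : 2 * G * f A / m * x = (G * f A * x) * (2 / m).
  by field; rewrite gt_eqF.
apply: ler_wpM2l; first by rewrite !mulr_ge0 // ltW.
rewrite ler_pdivrMr ?mulr_gt0 // mulrAC ler_pdivlMr //.
have ys : y <= p + q by lra.
apply: (@le_trans _ _ ((p + q) * m)); first by rewrite ler_pM2r.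
have h1 : p * m <= p * q by rewrite ler_pM2l.
have h2 : q * m <= q * p by rewrite ler_pM2l.
by lra.
Qed.

End CutFunctions.

(** * Termination, progress and guarantees of the loop *)

Section Procedure.
Variables (R : realType) (V : finType) (f : {set V} -> R) (w : V -> R).
Variables (g b b' : R) (A : {set V}).

(** The support of [w'] shrinks strictly: both sides of a candidate cut have positive weight, so
    [Si] contains a point where [w'] is nonzero. *)
Lemma step_terminates : terminates g b' f w.
Proof.
pose supp (s : state R V) := #|[set v | s.1 v != 0]|.
suff acc k s : (supp s < k)%N -> Acc (fun s' s => step g b' f w s s') s.
  exact: acc (ltnSn _).
elim: k s => [|k IH] s; first by rewrite ltn0.
rewrite ltnS => hs; constructor => s' st; apply: IH; apply: leq_trans hs.
rewrite /supp.
case: st => w' T S Si _ [[S1 S2] _] SiS _ /=.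
have Si0 : 0 < weight w' Si by case: SiS => ->.
have [v vSi w'v] : exists2 v, v \in Si & w' v != 0.
  apply/exists_inP; apply: contraTT Si0; rewrite negb_exists_in => /forall_inP h.
  by rewrite -leNgt /weight big1 // => v /h /negPn /eqP.
apply: proper_card; apply/properP; split.
  by apply/fintype.subsetP => u; rewrite !inE /zero_on; case: ifP; rewrite ?eqxx.
by exists v; rewrite !inE ?w'v // /zero_on vSi eqxx.
Qed.

Hypotheses (f0 : nonnegative f) (fsym : symmetric_setfun f) (fsub : submodular f).
Hypotheses (w0 : forall v, 0 <= w v).
Hypotheses (b'0 : 0 < b') (b'b : b' < b) (b'3 : b' <= 1 / 3).
Hypothesis (Abal : balanced w b A).
Local Notation W := (weight w [set: V]).

Lemma loop_guardE (w' : V -> R) (T : {set V}) : w' =1 zero_on T w ->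
  loop_guard b' w (w', T) <-> weight w T < b' * W.
Proof.
move=> e; rewrite /loop_guard /= (eq_weight _ e).
by have := weightT w T; split; lra.
Qed.

Lemma guard_weight_gt0 (T : {set V}) : weight w T < b' * W -> 0 < W.
Proof. by move=> /(le_lt_trans (weight_ge0 T w0)); rewrite pmulr_rgt0. Qed.

Lemma residual_balanced (T : {set V}) : weight w T < b' * W ->
  (b - b') * W <= weight (zero_on T w) A /\
  (b - b') * W <= weight (zero_on T w) (~: A).
Proof.
have [A1 A2] := Abal => hT.
have := zero_on_weight_ge T A w0; have := zero_on_weight_ge T (~: A) w0.
by split; lra.
Qed.

Definition cost_rate (G : R) : R := 2 * G * f A / ((b - b') * W).

(** Each step raises the cost bound by [cost_rate G] times the weight it removes. The bound [G]
    stands in for [g], whose sign is unknown. *)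
Lemma reachable_invariant (G : R) (s : state R V) : g <= G -> 0 <= G ->
  reachable g b' f w s ->
  [/\ s.1 =1 zero_on s.2 w, weight w s.2 <= (1 + b') / 2 * W
    & f s.2 <= f A + cost_rate G * weight w s.2].
Proof.
move=> gG G0 reach; elim: (clos_rt_rtn1 _ _ _ _ reach) => [|s1 s2 st _].
  rewrite /init /=; split.
  - by move=> v; rewrite /zero_on inE.
  - rewrite {1}/weight big_set0; apply: mulr_ge0; first by have := b'0; lra.
    exact: weight_ge0.
  - by rewrite /weight big_set0 mulr0 addr0 symmetric_submodular_set0_le.
case: st => w' T S Si gd ap SiS light /= [e hT hf].
move: gd => /(loop_guardE e) gd.
have W0 := guard_weight_gt0 gd.
have ew' : w' = zero_on T w by apply/funext.
have wTSi : weight w (T :|: Si) = weight w T + weight w' Si by rewrite weightU ew'.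
have [A1 A2] := residual_balanced gd.
have w'0 : forall v, 0 <= w' v by move=> v; rewrite e; exact: zero_on_ge0.
split.
- by move=> v; rewrite /zero_on inE e /zero_on; case: (v \in T); case: (v \in Si).
(* With $t=w(T)<b'W$ before the step, the lighter side adds at most $(W-t)/2$, so the new weight is
   at most $(W+t)/2$. *)
- have := weightC w' Si; have := weightT w T; rewrite -ew' wTSi => h1 h2; lra.
- rewrite wTSi mulrDr addrA.
  apply: (le_trans (submodular_subadditive f0 fsub _ _)); apply: lerD => //.
  rewrite -ew' in A1 A2.
  apply: (approx_sparsest_cut_le f0 fsym w'0 gG G0 _ A1 A2 ap SiS).
  by rewrite mulr_gt0 // subr_gt0.
Qed.

(** The residual balance of [A] makes it a candidate, so an exact minimizer exists; it is
    [g]-approximate once [1 <= g]. *)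
Lemma step_never_stuck : 1 <= g -> never_stuck g b' f w.
Proof.
move=> g1 [w' T] rs.
have [||/= e _ _] := reachable_invariant (G := g) _ _ rs; [by []|lra|] => gd.
have gd' := (loop_guardE e).1 gd.
have W0 := guard_weight_gt0 gd'.
have ew' : w' = zero_on T w by apply/funext.
have m0 : 0 < (b - b') * W by rewrite mulr_gt0 // subr_gt0.
have [A1 A2] := residual_balanced gd'.
have cA : candidate w' A by rewrite ew'; split; lra.
have [S Smin] := sparsest_cut_exists f cA.
have ap : approx_sparsest_cut g f w' S.
  split; first by case: Smin.
  exists S => //; rewrite ler_peMl // sparsity_ge0 //.
  by move=> v; rewrite e; exact: zero_on_ge0.
have [le|/ltW le] := leP (weight w' S) (weight w' (~: S)).
  by exists (zero_on S w', T :|: S); apply: (Step gd ap) => //; left.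
exists (zero_on (~: S) w', T :|: ~: S); apply: (Step gd ap); first by right.
by rewrite finset.setCK.
Qed.

Lemma returns_balanced (T : {set V}) : returns g b' f w T -> balanced w b' T.
Proof.
move=> [w' [rs ng]].
have [||/= e hT _] := reachable_invariant (G := `|g|) _ _ rs; rewrite ?ler_norm //.
have wT : b' * W <= weight w T.
  by rewrite leNgt; apply/negP => h; apply: ng; apply/(loop_guardE e).
split=> //; have sT := weightC w T.
have : 0 <= (1 - 3 * b') * W.
  by apply: mulr_ge0; [have := b'3; lra | exact: weight_ge0].
by lra.
Qed.

Lemma returns_cost_le (G : R) (T : {set V}) : g <= G -> 0 <= G ->
  returns g b' f w T -> f T <= f A + 2 * G * f A / (b - b').
Proof.
move=> gG G0 [w' [rs _]].
have [/= _ _ /le_trans] := reachable_invariant gG G0 rs; apply.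
rewrite lerD2l /cost_rate invfM mulrA -mulrA ler_piMr //.
  by rewrite divr_ge0 ?subr_ge0 ?(ltW b'b) // !mulr_ge0.
(* If the total weight is zero, its inverse is zero by convention and the cost term vanishes. *)
have := weight_ge0 [set: V] w0; rewrite le_eqVlt => /predU1P[<-|W0].
  by rewrite invr0 mul0r.
rewrite mulrC ler_pdivrMr // mul1r -(weightC w T) lerDl.
exact: weight_ge0.
Qed.

End Procedure.

(** * From the asymptotic ratio to a uniform constant *)

Section ApproximationRatio.
Variable R : realType.

Lemma sqrt_n_ln_ge1 (n : nat) : (2 <= n)%N -> 1 <= sqrt_n_ln R n.
Proof.
move=> n2; rewrite /sqrt_n_ln -[leLHS]sqrtr1 ler_wsqrtr //.
have n1 : 1 < n%:R :> R by rewrite ltr1n.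
have ln0 : 0 < ln n%:R :> R by exact: ln_gt0.
rewrite ler_pdivlMr // mul1r.
have := @le_ln1Dx R (n%:R - 1); rewrite subrKC => h.
by have : ln n%:R <= n%:R - 1 :> R; [apply: h; lra | lra].
Qed.

(* The asymptotic bound holds only from some rank N on; the finitely many
   earlier values are absorbed in the constant since [sqrt_n_ln] is at least 1. *)
Lemma bigO_sqrt_n_ln_uniform (gamma : nat -> R) :
  (gamma =O_\oo (@sqrt_n_ln R))%classic ->
  exists2 K : R, 0 <= K & forall n, (2 <= n)%N -> `|gamma n| <= K * sqrt_n_ln R n.
Proof.
move=> /eqO_exP[k k0 [N _ hN]].
have S0 : 0 <= \sum_(i < N) `|gamma i| by apply: sumr_ge0.
exists (k + \sum_(i < N) `|gamma i|) => [|n n2]; first exact: addr_ge0 (ltW k0) S0.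
have s1 := sqrt_n_ln_ge1 n2.
rewrite mulrDl; have [Nn|nN] := leqP N n.
  have := hN n Nn; rewrite /= [X in _ <= k * X]ger0_norm ?sqrtr_ge0 // => h.
  by apply: (le_trans h); rewrite lerDl mulr_ge0 //; lra.
apply: (@le_trans _ _ (\sum_(i < N) `|gamma i|)).
  by rewrite (bigD1 (Ordinal nN)) //= lerDl sumr_ge0.
by nra.
Qed.

End ApproximationRatio.

Local Open Scope classical_set_scope.
Local Open Scope ring_scope.

Theorem theorem10 (R : realType) (gamma : nat -> R)
    (gammaO : gamma =O_\oo (@sqrt_n_ln R)) :
  exists C : R, 0 < C /\
  forall (V : finType) (f : {set V} -> R) (w : V -> R) (b b' B : R),
    (2 <= #|V|)%N ->
    nonnegative f -> symmetric_setfun f -> submodular f ->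
    (forall v, 0 <= w v) ->
    0 < b' -> b' < b -> b <= 1 / 2 -> b' <= 1 / 3 ->
    (exists A : {set V}, balanced w b A /\ f A = B) ->
    [/\ terminates (gamma #|V|) b' f w,
        1 <= gamma #|V| -> never_stuck (gamma #|V|) b' f w
      & forall T : {set V}, returns (gamma #|V|) b' f w T ->
          balanced w b' T /\
          f T <= C * (B / (b - b') * sqrt_n_ln R #|V|)].
Proof.
have [K K0 hK] := bigO_sqrt_n_ln_uniform gammaO.
(* The 1 covers the cost of the initial empty set, and [2 * K] the accumulated cost of the steps. *)
exists (1 + 2 * K); split; first by lra.
move=> V f w b b' B n2 f0 fsym fsub w0 b'0 b'b b2 b'3 [A [Abal <-]].
split; [exact: step_terminates | exact: (step_never_stuck (b := b) (A := A)) |].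
move=> T rT; split; first exact: (returns_balanced (b := b) (A := A) f0 _ _ _ _ _ _ _ rT).
have s1 := sqrt_n_ln_ge1 R n2.
have G0 : 0 <= K * sqrt_n_ln R #|V| by rewrite mulr_ge0 //; lra.
have gG : gamma #|V| <= K * sqrt_n_ln R #|V| := le_trans (ler_norm _) (hK _ n2).
have db : 0 < b - b' by lra.
apply: (le_trans (returns_cost_le f0 fsym fsub w0 b'0 b'b Abal gG G0 rT)).
(* The additive term is absorbed because [b - b'] is below 1 and [sqrt_n_ln] is at least 1. *)
have fA : f A <= f A / (b - b') * sqrt_n_ln R #|V|.
  rewrite mulrAC ler_pdivlMr //; have := f0 A; nra.
have -> : 2 * (K * sqrt_n_ln R #|V|) * f A / (b - b')
  = 2 * K * (f A / (b - b') * sqrt_n_ln R #|V|) by ring.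
by rewrite [leRHS]mulrDl mul1r lerD2r.
Qed.
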